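(* Let $\alpha>3$, $t_0>0$, $x_0\in\mathcal H$, and let $x:[t_0,+\infty)\to\mathcal H$ be a bounded solution of the Cauchy problem $$\tfrac{\alpha}{t}\dot x(t)+\operatorname{proj}_{C(x(t))+\ddot x(t)}(0)=0\ (t>t_0),\qquad x(t_0)=x_0,\ \dot x(t_0)=0 .$$ Assume that every $f_i$ is bounded from below and that the Assumption on the weak Pareto set in the context holds. Then $x(t)$ converges weakly, as $t\to+\infty$, to a weakly Pareto optimal point of the problem $\min_{x\in\mathcal H}F(x)$.
   Context: $\mathcal H$ is a real Hilbert space. $f_1,\dots,f_m:\mathcal H\to\mathbb R$ are convex and continuously differentiable, and $F=(f_1,\dots,f_m)$. $C(x)=\operatorname{co}\{\nabla f_i(x):i=1,\dots,m\}$. For a closed convex $K\subset\mathcal H$, $\operatorname{proj}_K(y)=\arg\min_{w\in K}\|w-y\|^2$. A solution of the Cauchy problem is a function $x:[t_0,+\infty)\to\mathcal H$ such that: $x\in C^1([t_0,+\infty))$; $\dot x$ is absolutely continuous on $[t_0,T]$ for every $T\ge t_0$; there is a Bochner measurable $\ddot x$ with $\dot x(t)=\dot x(t_0)+\int_{t_0}^t\ddot x(s)\,ds$ for all $t$, and $\frac{d}{dt}\dot x=\ddot x$ a.e.; the equation holds for almost all $t\ge t_0$; and the initial conditions hold. A point $x^*$ is weakly Pareto optimal if there is no $x$ with $f_i(x)<f_i(x^* )$ for all $i$; $P_w$ denotes the set of such points. For $\hat F\in\mathbb R^m$, $\mathcal L(\hat F)=\{x:F(x)\le\hat F\}$ and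 $P_w(\hat F)=P_w\cap\mathcal L(\hat F)$. Assumption: for all $x_0\in\mathcal H$ and all $x\in\mathcal L(F(x_0))$ there exists $x^*\in P_w(F(x))$, and $$R:=\sup_{F^*\in F(P_w(F(x_0)))}\ \inf_{x\in F^{-1}(F^* )}\tfrac12\|x-x_0\|^2<+\infty .$$ *)

(* Defs.v *)
From HB Require Import structures.
From mathcomp Require Import all_boot all_order all_algebra.
From mathcomp Require Import all_classical all_reals all_analysis.
Set Implicit Arguments. Unset Strict Implicit. Unset Printing Implicit Defensive.
Import Order.TTheory GRing.Theory Num.Theory.
Import numFieldNormedType.Exports.
Local Open Scope classical_set_scope.
Local Open Scope ring_scope.

Section Defs.
Context {R : realType}.

Definition hilbert_ip (V : completeNormedModType R) (ip : V -> V -> R) : Prop :=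
  [/\ forall x y, ip x y = ip y x,
      forall (a : R) x y z, ip (a *: x + y) z = a * ip x z + ip y z
    & forall x, ip x x = `|x| ^+ 2].

Context {V : completeNormedModType R}.

Definition convex_fun (f : V -> R) : Prop :=
  forall (a : R) x y, 0 <= a <= 1 ->
    f (a *: x + (1 - a) *: y) <= a * f x + (1 - a) * f y.

Definition is_gradient (ip : V -> V -> R) (f : V -> R) (g : V -> V) : Prop :=
  forall y, differentiable f y /\ forall h, 'd f y h = ip (g y) h.

Definition co (m : nat) (p : 'I_m -> V) : set V :=
  [set \sum_(i < m) lam i *: p i | lam in
     [set lam : 'I_m -> R | (forall i, 0 <= lam i) /\ \sum_(i < m) lam i = 1]].

Definition is_proj (K : set V) (y p : V) : Prop :=
  K p /\ forall w, K w -> `|p - y| ^+ 2 <= `|w - y| ^+ 2.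

Definition abs_cont_on (u : R -> V) (a b : R) : Prop :=
  forall e : R, 0 < e -> exists2 d : R, 0 < d &
    forall n (ab : 'I_n -> R * R),
      (forall k, a <= (ab k).1 <= (ab k).2 /\ (ab k).2 <= b) ->
      (forall k l, k != l -> (ab k).2 <= (ab l).1 \/ (ab l).2 <= (ab k).1) ->
      \sum_(k < n) ((ab k).2 - (ab k).1) < d ->
      \sum_(k < n) `|u (ab k).2 - u (ab k).1| < e.

Definition strongly_measurable_on (D : set R) (u : R -> V) : Prop :=
  exists s : nat -> R -> V,
    (forall n, finite_set (range (s n)) /\
               forall v, measurable (s n @^-1` [set v])) /\
    forall t, D t -> s n t @[n --> \oo] --> u t.

End Defs.

Section Problem.
Context {R : realType} {V : completeNormedModType R}.
Variables (m : nat) (f : 'I_m -> V -> R).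

Definition Fv (y : V) : 'I_m -> R := fun i => f i y.

Definition level (Fh : 'I_m -> R) : set V := [set y | forall i, f i y <= Fh i].

Definition weak_pareto : set V :=
  [set xs | ~ exists y, forall i, f i y < f i xs].

Definition Pw_level (Fh : 'I_m -> R) : set V := weak_pareto `&` level Fh.

Definition Rsup (x0 : V) : \bar R :=
  ereal_sup [set ereal_inf [set ((2^-1 * `|y - x0| ^+ 2)%R)%:E
                            | y in [set y | Fv y = Fs]]
            | Fs in Fv @` Pw_level (Fv x0)].

Definition pareto_assumption : Prop :=
  forall x0 : V,
    (forall y, level (Fv x0) y -> exists xs, Pw_level (Fv y) xs) /\
    (Rsup x0 < +oo)%E.
End Problem.

Section Solution.
Context {R : realType} {V : completeNormedModType R}.
Variables (ip : V -> V -> R) (m : nat) (g : 'I_m -> V -> V).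

Definition Cset (y : V) : set V := co (fun i => g i y).

Definition C1_on (t0 : R) (x xd : R -> V) : Prop :=
  [/\ forall t, t0 < t -> is_derive t 1 x (xd t),
      h^-1 *: (x (t0 + h) - x t0) @[h --> 0^'+] --> xd t0
    & {within `[t0, +oo[, continuous xd}].

(* xdd is Bochner measurable, Bochner integrable on every [t0, T], and
   xd(t) = xd(t0) + \int_{t0}^t xdd(s) ds for t >= t0; the Bochner integral
   identity is expressed by testing against every v *)
Definition bochner_second_derivative (t0 : R) (xd xdd : R -> V) : Prop :=
  [/\ strongly_measurable_on `[t0, +oo[ xdd,
      (forall T, t0 <= T ->
         (@lebesgue_measure R).-integrable `[t0, T] (fun s => (`|xdd s|)%:E))
    & (forall t v, t0 <= t ->
         (ip (xd t - xd t0) v)%:E =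
         (\int[@lebesgue_measure R]_(s in `[t0, t]) (ip (xdd s) v)%:E)%E)].

Definition is_solution (alpha t0 : R) (x0 : V) (x xd xdd : R -> V) : Prop :=
  [/\ C1_on t0 x xd,
      (forall T, t0 <= T -> abs_cont_on xd t0 T),
      bochner_second_derivative t0 xd xdd,
      {ae @lebesgue_measure R, forall t, t0 < t -> is_derive t 1 xd (xdd t)}
    & [/\ {ae @lebesgue_measure R, forall t, t0 < t ->
             is_proj [set c + xdd t | c in Cset (x t)] 0 (- (alpha / t) *: xd t)},
          x t0 = x0
        & xd t0 = 0]].
End Solution.

(* Main.v *)
(** Put W_i = f_i(x) + |x'|^2 / 2. Comparing the projection with g_i(x) + x''
    gives W_i' <= - (alpha / t) |x'|^2, so W_i decreases to some w_i. For z with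
    F(z) <= w put A = t <x - z, x'> + (alpha - 1) |x - z|^2 / 2; convexity gives
    A' <= (3/2) t |x'|^2 - t min_i (W_i - f_i(z)), so that
    t^2 min_i (W_i - f_i(z)) + l A is nonincreasing for 2 <= l <= 2 alpha / 3.
    It is bounded below, since otherwise |x - z|^2 would decay like - log t.
    The choices l = 2 and l = 2 alpha / 3 differ because alpha > 3, hence A and
    t^2 min_i (W_i - f_i(z)) both converge. The first limit makes |x - z|
    converge, and Opial's argument yields weak convergence to a point xs with
    F(xs) <= w; the second shows that no z satisfies F(z) < F(xs). *)
Require Import Defs.
From HB Require Import structures.
From mathcomp Require Import all_boot all_order all_algebra.
From mathcomp Require Import all_classical all_reals all_analysis.
From mathcomp Require Import ring lra.
Import Order.TTheory GRing.Theory Num.Theory.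
Import numFieldNormedType.Exports.
Local Open Scope classical_set_scope.
Local Open Scope ring_scope.

(** * Monotonicity from slope bounds almost everywhere and absolute continuity *)

Section MonotoneAC.
Context {R : realType}.
Implicit Types a b s t c e : R.

(** Real induction: the supremum of the points of [a, b] where [P] holds can be crossed, so it is
    [b]. The step jumps from some s <= c to any t >= c close to [c], because [P] is not known at [c]
    itself beforehand. *)
Lemma interval_induction a b (P : R -> Prop) : a <= b -> P a ->
  (forall c, a <= c <= b -> exists2 d, 0 < d &
     forall s t, a <= s -> c - d < s -> s <= c -> c <= t -> t < c + d ->
       t <= b -> P s -> P t) ->
  P b.
Proof.
move=> ab Pa step.
pose A : set R := [set s | a <= s <= b /\ P s].
have Aa : A a by split; rewrite ?lexx.
have ubA : ubound A b by move=> s [/andP[]].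
have hsA : has_sup A by split; [exists a|exists b].
have ac : a <= sup A by apply: ub_le_sup => //; exists b.
have cb : sup A <= b by apply: ge_sup => //; exists a.
have [d d0 dP] := step (sup A) (introT andP (conj ac cb)).
have [s [/andP[sa sb] Ps] cs] := sup_adherent d0 hsA.
have sc : s <= sup A by apply: ub_le_sup; [exists b|split => //; rewrite sa sb].
pose t := Num.min b (sup A + d / 2).
have ct : sup A <= t by rewrite le_min cb /=; lra.
have tcd : t < sup A + d by rewrite gt_min; apply/orP; right; lra.
have tb : t <= b by rewrite ge_min lexx.
have Pt := dP s t sa cs sc ct tcd tb Ps.
have tc : t <= sup A.
  by apply: ub_le_sup; [exists b|split => //; rewrite tb (le_trans ac)].
have := tc; rewrite ge_min => /orP[bc|]; last by lra.
suff <- : t = b by [].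
by apply/eqP; rewrite eq_le tb (le_trans bc).
Qed.

Lemma negligible_open_cover (N : set R) e : 0 < e ->
  (@lebesgue_measure R).-negligible N ->
  exists U : set R, [/\ open U, N `<=` U & (lebesgue_measure U < e%:E)%E].
Proof.
move=> e0 [A [mA A0 NA]].
have [|U [oU AU Ue]] := lebesgue_regularity_outer mA _ e0.
  by apply: (@le_lt_trans _ _ 0%E); [rewrite le_eqVlt; apply/orP; left; apply/eqP|exact: ltry].
exists U; split=> //; first exact: subset_trans AU.
apply: le_lt_trans Ue.
have mU : measurable U by exact: measurable_realfun.open_measurable.
rewrite -[in X in (X <= _)%E](setDKU AU).
apply: (@le_trans _ _ (lebesgue_measure (U `\` A) + lebesgue_measure A)%E).
  by apply: measureU2 => //; exact: measurableD.
by rewrite [X in (_ + X)%E](_ : _ = 0%E) ?adde0.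
Qed.

Lemma near_interval (P : R -> Prop) t : (\forall s \near t, P s) ->
  exists2 d, 0 < d & forall s, t - d < s -> s < t + d -> P s.
Proof.
move=> /nbhs_ballP[d /= d0 dP]; exists d => // s ts st; apply: dP.
by rewrite /ball/= ltr_distlC ts st.
Qed.

(** The exceptional null set is covered by an open set of small measure. Across a point outside the
    cover, [u] grows with slope at most [e]. Inside it, the growth of [u] is dominated by length and
    by the variation of [v], which absolute continuity makes small. Real induction glues the two
    bounds. *)
Lemma ac_nonincreasing (V : completeNormedModType R) (v : R -> V) (u : R -> R)
    a b L :
  a <= b -> 0 <= L -> abs_cont_on v a b ->
  (forall s t, a <= s <= b -> a <= t <= b ->
     `|u s - u t| <= L * (`|s - t| + `|v s - v t|)) ->
  {ae @lebesgue_measure R, forall t, a <= t <= b -> forall e, 0 < e ->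
     \forall s \near t, (t <= s -> u s - u t <= e * (s - t)) /\
                        (s <= t -> u t - u s <= e * (t - s))} ->
  u b <= u a.
Proof.
move=> ab L0 ac dom good.
suff H e : 0 < e -> u b - u a <= e * (b - a) + L * (e + e).
  rewrite -subr_le0; apply/ler_addgt0Pr => r r0; rewrite add0r.
  have D0 : 0 < b - a + 2 * L + 1 by nra.
  (* The added 1 keeps the denominator positive when [a = b] and [L = 0]. *)
  have := H (r / (b - a + 2 * L + 1)) (divr_gt0 r0 D0).
  move=> /le_trans; apply.
  rewrite (_ : _ + _ = r / (b - a + 2 * L + 1) * (b - a + 2 * L)); last by ring.
  by rewrite -mulrA ger_pMr// mulrC ler_pdivrMr// mul1r; lra.
move=> e0.
have [d d0 dP] := ac e e0.
(* Total length below [d] makes the variation of [v] less than [e]; total length below [e] controls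
   the lengths themselves. *)
pose d' := Num.min d e.
have d'0 : 0 < d' by rewrite lt_min d0 e0.
have [U [oU NU Ud]] := negligible_open_cover _ _ d'0 good.
have mU : measurable U by exact: measurable_realfun.open_measurable.
(* [l] lists the disjoint intervals crossed inside [U], the latest first. Comparing their total
   length with the measure of [U] up to [s] keeps it below [d']. *)
pose P s := exists l : seq (R * R),
  [/\ all (fun p => [&& a <= p.1, p.1 <= p.2 & p.2 <= s]) l,
      pairwise (fun p q => q.2 <= p.1) l,
      ((\sum_(p <- l) (p.2 - p.1))%:E <=
         lebesgue_measure (U `&` `]-oo, s]))%E &
      u s - u a <= e * (s - a) +
        L * \sum_(p <- l) ((p.2 - p.1) + `|v p.2 - v p.1|)].
suff [l [la lp lU lu]] : P b.
  have Sd' : \sum_(p <- l) (p.2 - p.1) < d'.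
    rewrite -lte_fin (le_lt_trans lU)// (le_lt_trans _ Ud)//.
    by apply: le_measure; rewrite ?inE//; exact: measurableI.
  have /andP[Sd Se] : (\sum_(p <- l) (p.2 - p.1) < d) &&
    (\sum_(p <- l) (p.2 - p.1) < e) by rewrite -lt_min.
  apply: (le_trans lu); rewrite lerD2l ler_wpM2l// big_split/= lerD ?ltW//.
  rewrite (big_nth (0, 0)) big_mkord; apply: dP.
  - move=> k; have /allP/(_ (nth (0, 0) l k)) := la.
    by move/(_ (mem_nth _ (ltn_ord k))) => /and3P[-> -> ->].
  - move=> k k' kk'; have /(pairwiseP (0, 0)) H := lp.
    have := kk'; rewrite -val_eqE /= neq_ltn => /orP[lt|lt].
      by right; apply: H; rewrite ?inE ?ltn_ord.
    by left; apply: H; rewrite ?inE ?ltn_ord.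
  - by move: Sd; rewrite (big_nth (0, 0)) big_mkord.
apply: (interval_induction _ _ _ ab).
  exists [::]; rewrite !big_nil /= mulr0 !subrr mulr0 addr0; split => //.
move=> c cab.
(* Inside [U], the interval from [s] to [t] joins the list and the domination of [u] pays for it. *)
have [Uc|NUc] := pselect (U c).
  have [r r0 rP] := near_interval _ _ (open_nbhs_nbhs (conj oU Uc)).
  exists r => // s t as_ cs sc ct tc tb [l [la lp lU lu]].
  have st : s <= t by exact: le_trans ct.
  exists ((s, t) :: l); split.
  - rewrite /= as_ st lexx /=; apply: sub_all la => p /and3P[-> -> ps] /=.
    exact: le_trans st.
  - by rewrite /= lp andbT; apply: sub_all la => p /and3P[].
  - rewrite big_cons /= EFinD addeC.
    have -> : (t - s)%:E = lebesgue_measure (`]s, t]%classic : set R).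
      rewrite lebesgue_measure_itv /= lte_fin; case: ltP => // ts.
      by rewrite (_ : t = s) ?subrr//; apply/eqP; rewrite eq_le ts st.
    apply: (le_trans (leeD2r _ lU)).
    rewrite -measureU//.
    + apply: le_measure; rewrite ?inE//.
      * by apply: measurableU => //; exact: measurableI.
      * exact: measurableI.
      * move=> y [[Uy]|] /=; rewrite !in_itv /=.
          by move=> ys; split => //; exact: le_trans st.
        move=> /andP[sy yt]; split => //.
        by apply: rP; [exact: lt_trans sy|exact: le_lt_trans tc].
    + exact: measurableI.
    + apply/seteqP; split=> // y [[_]] /=; rewrite !in_itv /= => ys /andP[].
      by rewrite ltNge ys.
  - rewrite big_cons /=.
    have := dom t s; rewrite as_ tb (le_trans as_ st) (le_trans st tb).
    move=> /(_ isT isT); rewrite (ger0_norm (_ : 0 <= t - s)) ?subr_ge0// => D.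
    have := le_trans (ler_norm _) D; nra.
(* Outside [U], the slope bounds on both sides of [c] add up to u(t) - u(s) <= e (t - s), and the
   list is kept. *)
have gc : forall e, 0 < e -> \forall s \near c,
    (c <= s -> u s - u c <= e * (s - c)) /\ (s <= c -> u c - u s <= e * (c - s)).
  by move: NUc; apply: contra_notP => H; apply: NU => /(_ cab).
have [r r0 rP] := near_interval _ _ (gc e e0).
exists r => // s t as_ cs sc ct tc tb [l [la lp lU lu]].
have st : s <= t by exact: le_trans ct.
exists l; split => //.
- by apply: sub_all la => p /and3P[-> -> ps] /=; exact: le_trans st.
- apply: (le_trans lU); apply: le_measure; rewrite ?inE; [exact: measurableI..|].
  move=> y [Uy] /=; rewrite !in_itv /= => ys.
  by split => //; exact: le_trans st.
- have [] := rP t _ tc; first by lra.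
  move=> /(_ ct) + _.
  have [] := rP s cs _; first by lra.
  move=> _ /(_ sc); nra.
Qed.

End MonotoneAC.

(** * Functions whose increments are dominated by time and by a curve *)

Section LipDominated.
Context {R : realType} {V : completeNormedModType R}.
Variables (v : R -> V) (a b : R).
Implicit Types (X Y : normedZmodType R) (u w : R -> R) (s t e : R).

(** This class is stable under sums and, when [v] is bounded, under products and inner products; the
    absolute continuity of [v] then serves for every function built from it. *)
Definition lip_dom {X} (u : R -> X) := exists2 L : R, 0 <= L &
  forall s t, a <= s <= b -> a <= t <= b ->
    `|u s - u t| <= L * (`|s - t| + `|v s - v t|).

Lemma lip_dom_lipschitz X (u : R -> X) (K : R) : 0 <= K ->
  (forall s t, a <= s <= b -> a <= t <= b -> `|u s - u t| <= K * `|s - t|) ->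
  lip_dom u.
Proof.
move=> K0 H; exists K => // s t sab tab; apply: (le_trans (H _ _ sab tab)).
by rewrite ler_wpM2l// lerDl.
Qed.

Lemma lip_dom_cst X (k : X) : lip_dom (fun=> k).
Proof. by exists 0 => // s t _ _; rewrite subrr normr0 mul0r. Qed.

Lemma lip_dom_id : lip_dom (id : R -> R).
Proof. by apply: (@lip_dom_lipschitz _ _ 1) => // s t _ _; rewrite mul1r. Qed.

Lemma lip_dom_base : lip_dom v.
Proof. by exists 1 => // s t _ _; rewrite mul1r lerDr. Qed.

Lemma lip_domD X (u w : R -> X) :
  lip_dom u -> lip_dom w -> lip_dom (fun t => u t + w t).
Proof.
move=> [K K0 uK] [L L0 wL]; exists (K + L); first exact: addr_ge0.
move=> s t sab tab; rewrite mulrDl opprD addrACA.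
by rewrite (le_trans (ler_normD _ _))// lerD ?uK ?wL.
Qed.

Hypothesis v_bounded : exists M : R, forall t, a <= t <= b -> `|v t| <= M.

Lemma lip_dom_bounded X (u : R -> X) : lip_dom u ->
  exists2 B : R, 0 <= B & forall t, a <= t <= b -> `|u t| <= B.
Proof.
move: v_bounded => [M vM] [K K0 uK].
exists (`|u a| + K * (`|b - a| + (`|M| + `|M|))).
  by rewrite addr_ge0// mulr_ge0// !addr_ge0.
move=> t /[dup] tab /andP[at_ tb].
have ab : a <= b by exact: le_trans tb.
have aab : a <= a <= b by rewrite lexx.
rewrite -lerBlDl (le_trans (lerB_dist _ _))// (le_trans (uK _ _ tab aab))//.
rewrite ler_wpM2l// lerD//.
  by rewrite !ger0_norm ?subr_ge0 ?lerD2r.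
by rewrite (le_trans (ler_normB _ _))// lerD// (le_trans (vM _ _))// ?ler_norm.
Qed.

(* [op] stands for the multiplication of reals or an inner product. *)
Lemma lip_dom_bilinear X Y (op : X -> Y -> R) (u : R -> X) (w : R -> Y) :
  (forall p q r, op (p - q) r = op p r - op q r) ->
  (forall p q r, op r (p - q) = op r p - op r q) ->
  (forall p q, `|op p q| <= `|p| * `|q|) ->
  lip_dom u -> lip_dom w -> lip_dom (fun t => op (u t) (w t)).
Proof.
move=> opBl opBr op_le du dw.
have [B B0 uB] := lip_dom_bounded _ _ du; have [C C0 wC] := lip_dom_bounded _ _ dw.
move: du dw => [K K0 uK] [L L0 wL]; exists (B * L + C * K).
  by rewrite addr_ge0// mulr_ge0.
move=> s t sab tab.
have -> : op (u s) (w s) - op (u t) (w t) =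
    op (u s) (w s - w t) + op (u s - u t) (w t).
  by rewrite opBl opBr; ring.
rewrite (le_trans (ler_normD _ _))// mulrDl -!mulrA lerD//.
  by rewrite (le_trans (op_le _ _))// ler_pM ?uB ?wL.
by rewrite (le_trans (op_le _ _))// mulrC ler_pM ?wC ?uK.
Qed.

Lemma lip_domM u w : lip_dom u -> lip_dom w -> lip_dom (fun t => u t * w t).
Proof.
apply: lip_dom_bilinear => [p q r|p q r|p q].
- exact: mulrBl.
- exact: mulrBr.
- by rewrite normrM.
Qed.

End LipDominated.

(** * The minimum of a finite family *)

Section MinFamily.
Context {R : realType}.
Implicit Types (s t e : R).

Lemma derive_le0_straddle (u : R -> R) t (d e : R) : is_derive t 1 u d -> d <= 0 ->
  0 < e -> \forall s \near t, (t <= s -> u s - u t <= e * (s - t)) /\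
                              (s <= t -> u t - u s <= e * (t - s)).
Proof.
move=> [/cvg_ex[l /= ul] ud] d0 e0.
have ld : l = d by rewrite -ud; apply/esym/cvg_lim.
move: ul; rewrite ld => /cvgrPdist_lt/(_ _ e0) /= [r /= r0 rP].
exists r => // s /= str.
have [<-|ts] := eqVneq t s; first by rewrite !subrr mulr0; split.
have st0 : s - t != 0 by rewrite subr_eq0 eq_sym.
have := rP (s - t); rewrite /ball_ /= sub0r normrN distrC => /(_ str st0).
rewrite /GRing.scale/= mulr1 subrK ltr_distlC => /andP[_ H].
have {}H : (s - t)^-1 * (u s - u t) <= e by lra.
split=> [ts'|st'].
  have st : 0 < s - t by rewrite lt_neqAle eq_sym st0 subr_ge0.
  by move: H; rewrite mulrC ler_pdivrMr.
have st : 0 < t - s by rewrite lt_neqAle eq_sym subr_eq0 ts subr_ge0.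
rewrite -ler_pdivrMr// (le_trans _ H)// le_eqVlt; apply/orP; left; apply/eqP.
rewrite -(opprB t s) invrN -(opprB (u t)) mulNr mulrN opprK mulrC//.
Qed.

(** [ac_nonincreasing] is applied to the pointwise minimum. Only the indices that attain it need a
    derivative bound, since the others stay above it nearby. The conclusion compares the minimum at
    [b] with the one at [a]. *)
Lemma min_family_nonincreasing (I : finType) (V : completeNormedModType R)
    (v : R -> V) (E : I -> R -> R) (a b : R) :
  a <= b -> abs_cont_on v a b -> (forall i, lip_dom v a b (E i)) ->
  {ae @lebesgue_measure R, forall t, a <= t <= b ->
     (forall i, {for t, continuous (E i)}) /\
     forall i, (forall j, E i t <= E j t) ->
       exists2 e, e <= 0 & is_derive t 1 (E i) e} ->
  forall i, exists j, E j b <= E i a.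
Proof.
move=> ab ac dom good i0.
pose am t := [arg min_(i < i0) E i t]%O.
have amP t j : E (am t) t <= E j t.
  by rewrite /am; case: arg_minP => // i _; apply.
exists (am b); apply: le_trans (amP a i0).
have /choice[L LP] : forall i, exists L : R, 0 <= L /\
  forall s t, a <= s <= b -> a <= t <= b ->
    `|E i s - E i t| <= L * (`|s - t| + `|v s - v t|).
  by move=> i; have [L L0 LP] := dom i; exists L.
have leL i : L i <= \sum_j L j.
  by rewrite (bigD1 i)//= lerDl sumr_ge0// => j _; have [] := LP j.
apply: (@ac_nonincreasing R V v (fun t => E (am t) t) a b (\sum_i L i)) => //.
- by rewrite sumr_ge0// => i _; have [] := LP i.
- move=> s t sab tab.
  wlog H : s t sab tab / E (am t) t <= E (am s) s.
    move=> H; have [/H|/ltW/H] := leP (E (am t) t) (E (am s) s); first exact.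
    by rewrite (distrC (E _ _)) (distrC s) (distrC (v s)); exact.
  rewrite ger0_norm ?subr_ge0//.
  apply: (@le_trans _ _ (E (am t) s - E (am t) t)); first by rewrite lerD2r amP.
  rewrite (le_trans (ler_norm _))// (le_trans ((LP _).2 _ _ sab tab))//.
  by rewrite ler_wpM2r// addr_ge0.
suff key (t : R) : (forall i, {for t, continuous (E i)}) ->
    (forall i, (forall j, E i t <= E j t) ->
       exists2 e, e <= 0 & is_derive t 1 (E i) e) ->
    forall e, 0 < e -> \forall s \near t,
      (t <= s -> E (am s) s - E (am t) t <= e * (s - t)) /\
      (s <= t -> E (am t) t - E (am s) s <= e * (t - s)).
  apply: (@filterS _ _ (ae_filter_ringOfSetsType _) _ _ _ good) => t H tab.
  by have [cE dE] := H tab; exact: key.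
move=> cE dE e e0.
(* Near [t], an index attaining the minimum obeys the slope bound, and any other stays above the
   minimal value at [t]. *)
pose Q (j : I) (s : R) : Prop :=
    ((forall i, E j t <= E i t) -> (t <= s -> E j s - E j t <= e * (s - t)) /\
                        (s <= t -> E j t - E j s <= e * (t - s))) /\
    (E (am t) t < E j t -> E (am t) t < E j s).
have nE : \forall s \near t, forall j, Q j s.
  apply: (@filter_forall _ _ Q (nbhs t) (nbhs_filter t)) => j; apply: filterI.
    have [jm|nj] := pselect (forall i, E j t <= E i t); last first.
      by near=> s => /nj.
    have [d d0 dj] := dE j jm.
    by apply: filterS (derive_le0_straddle _ _ _ _ dj d0 e0).
  have [jt|tj] := ltP (E (am t) t) (E j t); last by near=> s.
  have cj : E j s @[s --> t] --> E j t by exact: cE.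
  by apply: filterS (cvgr_gt _ cj _ jt) => s ? _.
near=> s.
have Hs : forall j, Q j s by near: s; exact: nE.
split=> [ts|st].
  have [/(_ (amP t))[/(_ ts) + _ _]] := Hs (am t).
  by apply: le_trans; rewrite lerD2r amP.
(* To the left of [t], the minimiser at [s] either is not minimal at [t], and the difference is
   negative, or it is, and its own slope bound applies. *)
have [A B] := Hs (am s).
have [/B|le] := ltP (E (am t) t) (E (am s) t).
  rewrite -subr_lt0 => /ltW /le_trans; apply.
  by rewrite mulr_ge0 ?subr_ge0// ltW.
have [|_ /(_ st)] := A; first by move=> i; exact: le_trans (amP t i).
by apply: le_trans; rewrite lerD2r amP.
Unshelve. all: by end_near. Qed.

End MinFamily.

(** * Inner product calculus and nested convex sets *)

Section Hilbert.
Context {R : realType} {V : completeNormedModType R} {ip : V -> V -> R}.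
Hypothesis Hip : hilbert_ip ip.
Implicit Types (x y z v : V) (k e : R).

Lemma ipC x y : ip x y = ip y x. Proof. by case: Hip. Qed.

Lemma ipxx x : ip x x = `|x| ^+ 2. Proof. by case: Hip. Qed.

Lemma ipDl x y z : ip (x + y) z = ip x z + ip y z.
Proof. by case: Hip => _ H _; rewrite -[x in LHS]scale1r H mul1r. Qed.

Lemma ip0l z : ip 0 z = 0.
Proof. by have := ipDl 0 0 z; rewrite addr0; lra. Qed.

Lemma ipZl k x z : ip (k *: x) z = k * ip x z.
Proof. by case: Hip => _ H _; rewrite -[k *: x]addr0 H ip0l addr0. Qed.

Lemma ipNl x z : ip (- x) z = - ip x z.
Proof. by rewrite -scaleN1r ipZl mulN1r. Qed.

Lemma ipBl x y z : ip (x - y) z = ip x z - ip y z.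
Proof. by rewrite ipDl ipNl. Qed.

Lemma ipDr x y z : ip z (x + y) = ip z x + ip z y.
Proof. by rewrite ipC ipDl !(ipC z). Qed.

Lemma ipZr k x z : ip z (k *: x) = k * ip z x.
Proof. by rewrite ipC ipZl (ipC z). Qed.

Lemma ipBr x y z : ip z (x - y) = ip z x - ip z y.
Proof. by rewrite ipC ipBl !(ipC z). Qed.

Lemma ip_suml (I : finType) (F : I -> V) z : ip (\sum_i F i) z = \sum_i ip (F i) z.
Proof.
elim/big_rec2: _ => [|i y1 y2 _ <-]; first exact: ip0l.
exact: ipDl.
Qed.

(** Cauchy-Schwarz, by expanding the squared norm of |y|^2 x - <x, y> y. *)
Lemma ip_le_norm x y : `|ip x y| <= `|x| * `|y|.
Proof.
have [->|y0] := eqVneq y 0.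
  by rewrite normr0 mulr0 ipC ip0l normr0.
have y2 : 0 < `|y| ^+ 2 by rewrite exprn_gt0 ?normr_gt0.
rewrite -(@ler_pXn2r _ 2)// ?nnegrE ?mulr_ge0// real_normK ?num_real//.
have : 0 <= `|(`|y| ^+ 2) *: x - ip x y *: y| ^+ 2 by rewrite exprn_ge0.
rewrite -(ipxx (_ - _)) !(ipBl, ipBr, ipZl, ipZr) !ipxx (ipC y x) exprMn.
set X := `|x| ^+ 2; set Y := `|y| ^+ 2; set p := ip x y => H.
have : 0 <= Y * (X * Y - p ^+ 2) by apply: (le_trans H); rewrite /X /Y; nra.
by rewrite pmulr_rge0// subr_ge0.
Qed.

Lemma cvg_ip {T : Type} {F : set_system T} {FF : Filter F} (u w : T -> V) x y :
  u t @[t --> F] --> x -> w t @[t --> F] --> y ->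
  ip (u t) (w t) @[t --> F] --> ip x y.
Proof.
move=> ux wy; apply/cvgrPdist_le => e e0.
have N0 : 0 < `|x| + `|y| + 1 by rewrite ltr_wpDl// addr_ge0.
pose d := Num.min 1 (e / (`|x| + `|y| + 1)).
have d0 : 0 < d by rewrite lt_min ltr01 divr_gt0.
move/cvgrPdist_le/(_ _ d0) : ux => ux.
move/cvgrPdist_le/(_ _ d0) : wy => wy.
near=> t.
have tx : `|x - u t| <= d by near: t.
have ty : `|y - w t| <= d by near: t.
have -> : ip x y - ip (u t) (w t) =
    ip x (y - w t) + ip (x - u t) y - ip (x - u t) (y - w t).
  by rewrite !(ipBl, ipBr); ring.
have dle : d <= e / (`|x| + `|y| + 1) by rewrite ge_min lexx orbT.
have d1 : d <= 1 by rewrite ge_min lexx.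
apply: (@le_trans _ _ (d * (`|x| + `|y| + 1))); last first.
  by rewrite -ler_pdivlMr.
apply: (le_trans (ler_normB _ _)).
apply: (@le_trans _ _ ((`|x| * d + d * `|y|) + d * 1)); last by lra.
apply: lerD.
  apply: (le_trans (ler_normD _ _)); apply: lerD.
    by apply: (le_trans (ip_le_norm _ _)); rewrite ler_wpM2l.
  by apply: (le_trans (ip_le_norm _ _)); rewrite ler_wpM2r.
apply: (le_trans (ip_le_norm _ _)); rewrite ler_pM//.
exact: le_trans d1.
Unshelve. all: by end_near. Qed.

Lemma is_derive_ip (u w : R -> V) (t : R) x y :
  is_derive t 1 u x -> is_derive t 1 w y ->
  is_derive t 1 (fun s => ip (u s) (w s)) (ip x (w t) + ip (u t) y).
Proof.
move=> [du ux] [dw wy].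
have cw : {for t, continuous w}.
  by apply: differentiable_continuous; apply/derivable1_diffP.
have lu : h^-1 *: (u (h *: 1 + t) - u t) @[h --> 0^'] --> x.
  by rewrite -ux; exact: du.
have lw : h^-1 *: (w (h *: 1 + t) - w t) @[h --> 0^'] --> y.
  by rewrite -wy; exact: dw.
have cw' : w (h *: 1 + t) @[h --> (0 : R)^'] --> w t.
  have c0 : (h *: 1 + t : R) @[h --> (0 : R)] --> t.
    rewrite -[X in _ --> X]add0r; apply: cvgD; last exact: cvg_cst.
    under eq_fun do rewrite /GRing.scale/= mulr1.
    exact: cvg_id.
  apply: (cvg_comp (fun h : R => h *: 1 + t : R) w _ cw).
  by move=> A /c0; exact: nbhs_dnbhs.
have l : h^-1 *: (ip (u (h *: 1 + t)) (w (h *: 1 + t)) - ip (u t) (w t))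
    @[h --> 0^'] --> ip x (w t) + ip (u t) y.
  rewrite (_ : (fun h => _) = fun h => ip (h^-1 *: (u (h *: 1 + t) - u t))
      (w (h *: 1 + t)) + ip (u t) (h^-1 *: (w (h *: 1 + t) - w t))).
    by apply: cvgD; apply: cvg_ip => //; exact: cvg_cst.
  apply/funext => h; rewrite ipZl ipZr ipBl ipBr /GRing.scale/=; ring.
split; first by apply/cvg_ex; eexists; exact: l.
exact: cvg_lim l.
Qed.

(** This replaces weak compactness of bounded sets. Points of almost minimal norm form a Cauchy
    sequence by the parallelogram identity, because their midpoints cannot have much smaller norm;
    the limit lies in every set. *)
Lemma nested_convex_nonempty (C : nat -> set V) (M : R) :
  (forall n, C n.+1 `<=` C n) -> (forall n, C n !=set0) ->
  (forall n x, C n x -> `|x| <= M) ->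
  (forall n x y, C n x -> C n y -> C n (2^-1 *: (x + y))) ->
  (forall n (u : nat -> V) l, (forall j, C n (u j)) -> u j @[j --> \oo] --> l ->
     C n l) ->
  exists z, forall n, C n z.
Proof.
move=> decr ne bd mid clo.
have mono n m : (n <= m)%N -> C m `<=` C n.
  elim: m => [|m IH]; first by rewrite leqn0 => /eqP ->.
  rewrite leq_eqVlt => /orP[/eqP -> //|nm].
  by apply: (subset_trans (decr m)); exact: IH.
pose N n : set R := [set `|y| | y in C n].
pose d n := inf (N n).
have hi n : has_inf (N n).
  split; first by have [y Cy] := ne n; exists `|y|, y.
  by exists 0 => _ [y _ <-].
have dle n y : C n y -> d n <= `|y|.
  by move=> Cy; apply: ge_inf; [case: (hi n)|exists y].
have d0 n : 0 <= d n.
  by apply: lb_le_inf; [case: (hi n)|move=> _ [y _ <-]].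
have dM n : d n <= M.
  by have [y Cy] := ne n; apply: le_trans (dle n y Cy) (bd n y Cy).
have hs : has_sup (range d).
  by split; [exists (d 0%N), 0%N|exists M => _ [n _ <-]].
pose D := sup (range d).
have dD n : d n <= D by apply: ub_le_sup; [case: hs|exists n].
have D0 : 0 <= D by exact: le_trans (dD 0%N).
have /choice[p pP] : forall n, exists y, C n y /\ `|y| < D + n.+1%:R^-1.
  move=> n.
  have n0 : (0 : R) < n.+1%:R^-1 by rewrite invr_gt0.
  have [_ [y Cy <-] yd] := inf_adherent n0 (hi n).
  by exists y; split => //; apply: (lt_le_trans yd); rewrite lerD2r; exact: dD.
have cau : cauchy_ex (p n @[n --> \oo]).
  move=> e e0.
  (* The parallelogram identity yields |p n - p m|^2 <= 8 h (2 D + 1), and the factor 16 leaves room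
     for strictness. The bound [h <= 1] gives D + h + d n1 <= 2 D + 1. *)
  pose h := Num.min 1 (e ^+ 2 / (16 * (2 * D + 1))).
  have h0 : 0 < h.
    by rewrite lt_min ltr01 divr_gt0 ?exprn_gt0//; lra.
  have h1 : h <= 1 by rewrite ge_min lexx.
  have he : 16 * h * (2 * D + 1) <= e ^+ 2.
    have : h <= e ^+ 2 / (16 * (2 * D + 1)) by rewrite ge_min lexx orbT.
    by rewrite ler_pdivlMr; lra.
  have [_ [n1 _ <-] n1D] := sup_adherent h0 hs.
  have [n2 n2h] : exists n2, (n2.+1%:R^-1 : R) < h.
    have [k kh] := ltr_add_invr (y := 0) (x := h) h0.
    by exists k; rewrite add0r in kh.
  (* [n1] brings the minimal norm within [h] of its limit [D]; [n2] makes the defect of the chosen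
     points less than [h]. *)
  pose n := maxn n1 n2; exists (p n), n => // m /= nm.
  rewrite /= -ball_normE /ball_ /=.
  have inv (k : nat) : (n2 <= k)%N -> `|p k| < D + h.
    move=> n2k; have [_ /lt_trans] := pP k; apply.
    rewrite ltrD2l; apply: le_lt_trans n2h.
    by rewrite lef_pV2 ?posrE// ler_nat ltnS.
  have pn : `|p n| < D + h by apply: inv; exact: leq_maxr.
  have pm : `|p m| < D + h by apply: inv; exact: leq_trans (leq_maxr _ _) nm.
  have Cn : C n1 (2^-1 *: (p n + p m)).
    apply: mid; [apply: (mono n1 n); [exact: leq_maxl|]|apply: (mono n1 m)].
    - by have [] := pP n.
    - exact: leq_trans (leq_maxl _ _) nm.
    - by have [] := pP m.
  have := dle _ _ Cn; rewrite normrZ ger0_norm ?invr_ge0// => dmid.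
  have para : `|p n - p m| ^+ 2 = 2 * `|p n| ^+ 2 + 2 * `|p m| ^+ 2 -
      `|p n + p m| ^+ 2.
    by rewrite -!ipxx !(ipBl, ipBr, ipDl, ipDr); ring.
  rewrite -(@ltr_pXn2r _ 2)// ?nnegrE ?(ltW e0)// para.
  have := dD n1; have := d0 n1; have := normr_ge0 (p n); have := normr_ge0 (p m).
  move: pn pm n1D dmid; rewrite -/D.
  move: (`|p n|) (`|p m|) (`|p n + p m|) (d n1) => A B S dd.
  move=> AD BD ddD ddS B0 A0 dd0 ddD'.
  have A2 : A ^+ 2 <= (D + h) ^+ 2 by rewrite ler_pXn2r ?nnegrE//; lra.
  have B2 : B ^+ 2 <= (D + h) ^+ 2 by rewrite ler_pXn2r ?nnegrE//; lra.
  have S2 : (2 * dd) ^+ 2 <= S ^+ 2 by rewrite ler_pXn2r ?nnegrE//; lra.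
  have key : (D + h) ^+ 2 - dd ^+ 2 <= 2 * h * (2 * D + 1).
    rewrite subr_sqr.
    by apply: ler_pM; lra.
  have hp : 0 < h * (2 * D + 1) by apply: mulr_gt0 => //; lra.
  move: S2; rewrite exprMn; lra.
have /cvg_ex[z pz] : cvg (p n @[n --> \oo]) by apply/cauchy_cvgP/cauchy_exP.
exists z => n; apply: (clo n (fun j => p (j + n)%N)).
  move=> k; apply: (mono n (k + n)%N); first exact: leq_addl.
  by have [] := pP (k + n)%N.
by rewrite (cvg_shiftn n p).
Qed.

End Hilbert.

(** * Hull points of a trajectory and Opial's lemma *)

Section Opial.
Context {R : realType} {V : completeNormedModType R} {ip : V -> V -> R}.
Hypothesis Hip : hilbert_ip ip.
Variable x : R -> V.

(* [z] lies in the closed convex hull of the tail of [x] along [A]; the hull is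
   tested by sublevel sets of continuous convex functions. *)
Definition hull_point (A : set R) (z : V) : Prop :=
  forall phi : V -> R, convex_fun phi -> continuous phi -> forall c T : R,
    (forall t, T <= t -> A t -> phi (x t) <= c) -> phi z <= c.

Lemma convex_fun_ip (v : V) : convex_fun (fun y => ip y v).
Proof. by move=> a y z _; rewrite (ipDl Hip) !(ipZl Hip). Qed.

Lemma continuous_ip (v : V) : continuous (fun y => ip y v).
Proof. by move=> y; apply: (cvg_ip Hip) => //; exact: cvg_cst. Qed.

(** The hulls of the tails t >= n decrease, are closed and stable under midpoints, and are bounded
    because the norm is an admissible test function; hence they share a point. *)
Lemma hull_point_exists (A : set R) (M : R) :
  (forall t, A t -> `|x t| <= M) -> (forall T, exists2 t, T <= t & A t) ->
  exists z, hull_point A z.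
Proof.
move=> bd ub.
pose C (n : nat) : set V := [set y | forall phi : V -> R, convex_fun phi ->
  continuous phi -> forall c : R,
    (forall t, n%:R <= t -> A t -> phi (x t) <= c) -> phi y <= c].
have [|||||z Cz] := @nested_convex_nonempty R V ip Hip C M.
- move=> n y Cy phi cphi kphi c H; apply: (Cy phi cphi kphi) => t nt.
  by apply: H; apply: le_trans nt; rewrite ler_nat.
- by move=> n; have [t nt At] := ub n%:R; exists (x t) => phi _ _ c; apply.
- move=> n y /(_ (fun y => `|y|)); apply; last by move=> t _ /bd.
    move=> a y1 y2 /andP[a0 a1]; rewrite (le_trans (ler_normD _ _))// !normrZ.
    by rewrite !ger0_norm ?subr_ge0.
  exact: norm_continuous.
- move=> n y z Cy Cz phi cphi kphi c H.
  have := cphi 2^-1 y z; rewrite (_ : 1 - 2^-1 = 2^-1); last by lra.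
  rewrite -scalerDr => /(_ _)/le_trans; apply; first by lra.
  have := Cy _ cphi kphi c H; have := Cz _ cphi kphi c H; lra.
- move=> n u l Cu ul phi cphi kphi c H.
  have cl : phi (u j) @[j --> \oo] --> phi l by apply: cvg_comp ul _; exact: kphi.
  apply: (cvgr_to_le cl); near=> j.
  exact: (Cu j phi cphi kphi c H).
exists z => phi cphi kphi c T H.
apply: (Cz (Num.bound `|T|) phi cphi kphi) => t Tt; apply: H; apply: le_trans Tt.
by rewrite (le_trans (ler_norm _))// ltW// archi_boundP.
Unshelve. all: by end_near. Qed.

Lemma hull_point_sub (A B : set R) z : A `<=` B -> hull_point A z -> hull_point B z.
Proof.
move=> AB Az phi cphi kphi c T H; apply: (Az phi cphi kphi c T) => t Tt /AB.
exact: H.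
Qed.

(** The linear forms given by [v] and [-v] are both convex test functions, and they give the two
    inequalities. *)
Lemma hull_point_ip_limit (A : set R) z v l : hull_point A z ->
  ip (x t) v @[t --> +oo] --> l -> ip z v = l.
Proof.
move=> Az /cvgrPdist_le xl.
have nv w : ip w (- v) = - ip w v by rewrite (ipC Hip) (ipNl Hip) (ipC Hip).
apply/eqP; rewrite eq_le; apply/andP; split; apply/ler_addgt0Pr => e e0.
  have [T [_ TP]] := xl _ e0.
  apply: (Az _ (convex_fun_ip v) (continuous_ip v) _ (T + 1)) => t Tt _.
  by have := TP t; rewrite ler_distlC => /(_ _)/andP[]; lra.
have [T [_ TP]] := xl _ e0.
have : ip z (- v) <= - (l - e).
  apply: (Az _ (convex_fun_ip _) (continuous_ip _) _ (T + 1)) => t Tt _.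
  by rewrite nv; have := TP t; rewrite ler_distlC => /(_ _)/andP[]; lra.
by rewrite nv; lra.
Qed.

(* Opial's lemma without weak compactness: a direction along which [x] stays away
   from a hull point [z] produces a second hull point [z'], and the convergence of
   [<x, z - z'>] forces [z = z']. *)
Lemma opial (S : set V) (t0 M : R) : (forall t, t0 <= t -> `|x t| <= M) ->
  (forall z, hull_point setT z -> S z) ->
  (forall y z, S y -> S z -> exists l : R, ip (x t) (y - z) @[t --> +oo] --> l) ->
  exists2 z, S z & forall v, ip (x t) v @[t --> +oo] --> ip z v.
Proof.
move=> bd hS lim.
have [|T|z hz] := @hull_point_exists [set t | t0 <= t] M; first exact: bd.
  by exists (Num.max T t0); rewrite /= le_max lexx ?orbT.
have Sz : S z by apply: hS; apply: hull_point_sub hz.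
exists z => //.
have half v e : 0 < e -> \forall t \near +oo, ip (x t - z) v <= e.
  move=> e0; apply: contrapT => H.
  pose A : set R := [set t | t0 <= t /\ e < ip (x t - z) v].
  have [t [tt _]||z' hz'] := @hull_point_exists A M; first exact: bd.
    move=> T; apply: contrapT => NT; apply: H.
    exists (Num.max T t0); split; first exact: num_real.
    move=> t; rewrite gt_max => /andP[Tt tt]; rewrite leNgt; apply/negP => et.
    by apply: NT; exists t; [exact: ltW|split => //; exact: ltW].
  have Sz' : S z' by apply: hS; apply: hull_point_sub hz'.
  have [l xl] := lim z z' Sz Sz'.
  have e1 := hull_point_ip_limit _ _ _ _ hz xl.
  have e2 := hull_point_ip_limit _ _ _ _ hz' xl.
  have : `|z - z'| ^+ 2 = 0 by rewrite -(ipxx Hip) (ipBl Hip) e1 e2 subrr.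
  move=> /eqP; rewrite expf_eq0 normr_eq0 subr_eq0 => /eqP zz'.
  have : ip z' (- v) <= - (ip z v + e).
    apply: (hz' _ (convex_fun_ip _) (continuous_ip _) _ 0) => t _ [_].
    by rewrite (ipBl Hip) (ipC Hip _ (- v)) (ipNl Hip) (ipC Hip v); lra.
  by rewrite zz' (ipC Hip _ (- v)) (ipNl Hip) (ipC Hip v); lra.
move=> v; apply/cvgrPdist_le => e e0; near=> t.
have h1 : ip (x t - z) v <= e by near: t; exact: half.
have h2 : ip (x t - z) (- v) <= e by near: t; exact: half.
move: h1 h2; rewrite (ipC Hip _ (- v)) (ipNl Hip) (ipC Hip v) (ipBl Hip) => h1 h2.
by rewrite ler_distlC; lra.
Unshelve. all: by end_near. Qed.

End Opial.

(** * Limits of scalar functions under differential inequalities *)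

Section Asymptotics.
Context {R : realType}.
Implicit Types (u h dh : R -> R) (s t T e k l : R).

Lemma derive_le0_nonincreasing u (du : R -> R) T :
  (forall t, T < t -> is_derive t 1 u (du t)) -> (forall t, T < t -> du t <= 0) ->
  forall s t, T < s -> s <= t -> u t <= u s.
Proof.
move=> ud d0 s t Ts st.
have [||c] := @MVT_segment R u du s t st.
- by move=> c; rewrite in_itv /= => /andP[sc _]; apply: ud; exact: lt_trans sc.
- apply: continuous_in_subspaceT => c; rewrite inE /= in_itv /= => /andP[sc _].
  apply: differentiable_continuous; apply/derivable1_diffP.
  by have [] := ud c (lt_le_trans Ts sc).
rewrite in_itv /= => /andP[sc _] E.
rewrite -subr_le0 E mulr_le0_ge0 ?subr_ge0//.
by apply: d0; exact: lt_le_trans sc.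
Qed.

Lemma nonincreasing_bounded_cvg u T (B : R) :
  (forall s t, T < s -> s <= t -> u t <= u s) -> (forall t, T < t -> B <= u t) ->
  exists l, u t @[t --> +oo] --> l /\ forall t, T < t -> l <= u t.
Proof.
move=> mono lb.
pose A : set R := [set u t | t in [set t | T < t]].
have hA : has_inf A.
  split; first by exists (u (T + 1)), (T + 1) => //=; lra.
  by exists B => _ [t Tt <-]; exact: lb.
have infle t : T < t -> inf A <= u t.
  by move=> Tt; apply: ge_inf; [case: hA|exists t].
exists (inf A); split => //; apply/cvgrPdist_le => e e0.
have [_ [s Ts <-] se] := inf_adherent e0 hA.
exists s; split; first exact: num_real.
move=> t st; have Tt : T < t by exact: lt_trans st.
have := mono s t Ts (ltW st); have := infle t Tt.
by rewrite ler_distlC; lra.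
Qed.

(** The sum h + ln is nonincreasing, whereas ln is unbounded and h is nonnegative. *)
Lemma no_log_decay h dh T : 0 < T ->
  (forall t, T < t -> is_derive t 1 h (dh t)) -> (forall t, T < t -> 0 <= h t) ->
  (forall t, T < t -> t * dh t <= -1) -> False.
Proof.
move=> T0 hd h0 dle.
have T1 : 0 < T + 1 by lra.
have mono : forall s t, T < s -> s <= t -> (h \+ @ln R) t <= (h \+ @ln R) s.
  apply: (@derive_le0_nonincreasing _ (fun t => dh t + t^-1)) => t Tt.
    have t0 : 0 < t by exact: lt_trans Tt.
    by apply: is_deriveD; [exact: hd|exact: is_derive1_ln].
  have t0 : 0 < t by exact: lt_trans Tt.
  rewrite -(pmulr_rle0 _ t0) mulrDr divff ?gt_eqF//.
  by have := dle t Tt; lra.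
pose K := h (T + 1) + ln (T + 1).
pose t := Num.max (T + 1) (expR (K + 1)).
have Tt : T + 1 <= t by rewrite le_max lexx.
have := mono (T + 1) t _ Tt; rewrite /= => /(_ _).
have lnt : K + 1 <= ln t.
  rewrite -[leLHS]expRK ler_ln ?posrE ?expR_gt0// ?le_max ?lexx ?orbT//.
  by rewrite lt_max T1.
have := h0 t; rewrite -/K; lra.
Qed.

(** The integrating factor t^b works: t^b (h - k/b - e/2) has derivative t^(b-1) (t h' + b h - k - b
    e/2), which is eventually nonpositive, so h - k/b - e/2 is at most a constant times t^(-b). *)
Lemma limsup_first_order h dh T (b k : R) : 0 < T -> 0 < b ->
  (forall t, T < t -> is_derive t 1 h (dh t)) ->
  (forall e, 0 < e -> \forall t \near +oo, t * dh t + b * h t <= k + e) ->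
  forall e, 0 < e -> \forall t \near +oo, h t <= k / b + e.
Proof.
move=> T0 b0 hd lim e e0.
have be0 : 0 < b * (e / 2) by rewrite mulr_gt0// divr_gt0.
have [T1 [_ T1P]] := lim _ be0.
pose T2 := Num.max T T1.
have T20 : 0 < T2 by rewrite lt_max T0.
pose g := fun t => h t - (k / b + e / 2).
have mono : forall s t, T2 < s -> s <= t ->
    (((@powR R) ^~ b) * g) t <= (((@powR R) ^~ b) * g) s.
  apply: (@derive_le0_nonincreasing _
    (fun t => t `^ b *: dh t + g t *: (b * t `^ (b - 1)))) => t.
    rewrite gt_max => /andP[Tt _]; apply: is_deriveM.
      by apply: is_derive1_powR; exact: lt_trans Tt.
    rewrite -[dh t]subr0; apply: is_deriveB; exact: hd.
  rewrite gt_max => /andP[Tt T1t].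
  have t0 : 0 < t by exact: lt_trans Tt.
  have -> : t `^ b = t `^ (b - 1) * t.
    by rewrite -[X in _ * X]powRr1 ?ltW// -powRD ?subrK// gt_eqF ?implybT.
  have := T1P t T1t => H.
  have p0 : 0 <= t `^ (b - 1) by exact: powR_ge0.
  rewrite /GRing.scale/= (_ : _ + _ = t `^ (b - 1) * (t * dh t + b * g t)).
    by rewrite mulr_ge0_le0// /g mulrBr mulrDr (mulrCA b k) divff ?gt_eqF//; lra.
  by ring.
pose C := (T2 + 1) `^ b * g (T2 + 1).
(* Beyond the second bound, |C| / t^b <= e / 2. *)
pose X := Num.max (T2 + 1) ((2 * `|C| / e) `^ b^-1).
exists X; split; first exact: num_real.
move=> t; rewrite gt_max => /andP[T2t Xt].
have := mono (T2 + 1) t; rewrite {1 2}/GRing.mul/= -/C => /(_ _ (ltW T2t)) H.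
have {}H : t `^ b * g t <= C by apply: H; lra.
have C0 : 0 <= 2 * `|C| / e by apply: divr_ge0; [rewrite mulr_ge0|exact: ltW].
have t0 : 0 < t by lra.
have tb : 2 * `|C| / e <= t `^ b.
  rewrite -[leLHS](_ : (2 * `|C| / e) `^ b^-1 `^ b = _); last first.
    by rewrite -powRrM mulVf ?gt_eqF// powRr1.
  apply: ge0_ler_powR; rewrite ?nnegrE ?powR_ge0 ?(ltW b0) ?(ltW t0) ?(ltW Xt)//.
have p0 : 0 < t `^ b by exact: powR_gt0.
suff : g t <= e / 2 by rewrite /g; lra.
rewrite -(ler_pM2l p0) (le_trans H)// (le_trans (ler_norm _))//.
by move: tb; rewrite ler_pdivrMr//; lra.
Qed.

(** The one-sided estimate is applied to [h] and to [-h]. *)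
Lemma cvg_first_order h dh T (b k : R) : 0 < T -> 0 < b ->
  (forall t, T < t -> is_derive t 1 h (dh t)) ->
  t * dh t + b * h t @[t --> +oo] --> k -> h t @[t --> +oo] --> k / b.
Proof.
move=> T0 b0 hd /cvgrPdist_le lim.
have up := @limsup_first_order h dh T b k T0 b0 hd.
have lo := @limsup_first_order (fun t => - h t) (fun t => - dh t) T b (- k) T0 b0.
apply/cvgrPdist_le => e e0; near=> t; rewrite ler_distlC.
have h1 : h t <= k / b + e.
  near: t; apply: up => // r /lim; apply: filterS => t.
  by rewrite ler_distlC => /andP[].
have h2 : - h t <= - k / b + e.
  near: t; apply: lo => // [t Tt|r /lim]; first by apply: is_deriveN; exact: hd.
  apply: filterS => t; rewrite ler_distlC => /andP[]; lra.
by apply/andP; split; lra.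
Unshelve. all: by end_near. Qed.

End Asymptotics.

(** * Gradient inequality and projection onto a translated convex hull *)

Section ConvexGradient.
Context {R : realType} {V : completeNormedModType R} {ip : V -> V -> R}.
Hypothesis Hip : hilbert_ip ip.

(** By convexity the difference quotients from [y] towards [z] are at most f(z) - f(y), hence so is
    their limit. *)
Lemma convex_gradient_le (f : V -> R) (g : V -> V) : convex_fun f ->
  is_gradient ip f g -> forall y z, f y - f z <= ip (g y) (y - z).
Proof.
move=> cf gf y z; have [df dfE] := gf y.
rewrite leNgt; apply/negP => H.
have {}H : f z - f y < 'D_(z - y) f y.
  by rewrite deriveE// dfE -(opprB y z) (ipC Hip) (ipNl Hip) (ipC Hip); lra.
have dq : derivable f y (z - y) by exact: diff_derivable.
have lq : h^-1 *: (f (h *: (z - y) + y) - f y) @[h --> 0^'] --> 'D_(z - y) f y.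
  exact: dq.
have [r /= r0 rP] := cvgr_gt _ lq _ H.
pose h := Num.min r 1 / 2.
have m0 : 0 < Num.min r 1 by rewrite lt_min r0 ltr01.
have h0 : 0 < h by rewrite divr_gt0.
have hr : h < r.
  have : Num.min r 1 <= r by rewrite ge_min lexx.
  by rewrite /h; lra.
have h1 : h <= 1.
  have : Num.min r 1 <= 1 by rewrite ge_min lexx orbT.
  by rewrite /h; lra.
have : f z - f y < h^-1 * (f (h *: (z - y) + y) - f y).
  apply: (rP h); last exact: lt0r_neq0.
  by rewrite /ball_ /= sub0r normrN gtr0_norm.
rewrite mulrC ltr_pdivlMr//.
have := cf h z y; rewrite (ltW h0) h1 => /(_ isT).
rewrite (_ : h *: z + (1 - h) *: y = h *: (z - y) + y); first by nra.
by rewrite scalerBl scale1r scalerBr addrCA addrC.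
Qed.

Lemma is_derive_gradient_comp (f : V -> R) (g : V -> V) (x : R -> V) (t : R) (v : V) :
  is_gradient ip f g -> is_derive t 1 x v ->
  is_derive t 1 (fun s => f (x s)) (ip (g (x t)) v).
Proof.
move=> gf [/derivable1_diffP dx xv]; have [df dfE] := gf (x t).
have dfx : differentiable (f \o x) t by exact: differentiable_comp.
split; first exact/derivable1_diffP.
by rewrite deriveE// diff_comp//= dfE -xv deriveE.
Qed.

(** The second part is the variational inequality of the projection: moving [w] towards the vertex
    [p i + q] stays in the set and cannot decrease the norm. *)
Lemma is_proj_co (m : nat) (p : 'I_m -> V) (q w : V) :
  is_proj [set c + q | c in co p] 0 w ->
  (exists lam : 'I_m -> R, [/\ forall i, 0 <= lam i, \sum_i lam i = 1 &
     w = \sum_i lam i *: p i + q]) /\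
  forall i, `|w| ^+ 2 <= ip w (p i + q).
Proof.
move=> [[c [lam [lam0 lam1] <-] wE] wmin]; split.
  by exists lam; split.
move=> i; have [d dE] : exists d, d = p i + q - w by eexists.
have H h : 0 <= h <= 1 -> 0 <= 2 * h * ip w d + h ^+ 2 * `|d| ^+ 2.
  move=> /andP[h0 h1].
  have /wmin : [set c + q | c in co p] (w + h *: d).
    exists (\sum_j ((1 - h) * lam j + h * (j == i)%:R) *: p j); last first.
      rewrite dE -wE.
      under eq_bigr do rewrite scalerDl -!scalerA.
      rewrite big_split /= -!scaler_sumr.
      rewrite (_ : \sum_j (j == i)%:R *: p j = p i); last first.
        rewrite (bigD1 i)//= eqxx scale1r big1 ?addr0// => j /negbTE ->.
        exact: scale0r.
      rewrite opprD addrACA subrr addr0 scalerBr scalerBl scale1r.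
      by rewrite [RHS]addrAC; congr (_ + _); rewrite [RHS]addrA [RHS]addrAC.
    exists (fun j => (1 - h) * lam j + h * (j == i)%:R) => //; split.
      by move=> j; rewrite addr_ge0// mulr_ge0// subr_ge0.
    rewrite big_split /= -!mulr_sumr lam1 (bigD1 i)//= eqxx big1 ?addr0.
      by rewrite !mulr1 subrK.
    by move=> j /negbTE ->.
  rewrite !subr0 -!(ipxx Hip) !(ipDl Hip, ipDr Hip, ipZl Hip, ipZr Hip).
  by rewrite (ipC Hip d w); lra.
suff : 0 <= ip w d by rewrite dE (ipBr Hip) (ipxx Hip) subr_ge0.
rewrite leNgt; apply/negP => wd.
set N := `|d| ^+ 2 in H.
have N0 : 0 <= N by rewrite exprn_ge0.
(* The quadratic in [h] is tested at its minimiser - <w, d> / N, or at 1 when that lies beyond the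
   unit interval or N = 0. *)
have [Nw|Nw] := leP N (- ip w d).
  by have := H 1; rewrite ler01 lexx => /(_ isT); lra.
have Np : 0 < N by lra.
pose h := - ip w d / N.
have hN : h * N = - ip w d by rewrite /h divfK ?gt_eqF.
have h0 : 0 < h by rewrite divr_gt0// oppr_gt0.
have := H h; rewrite (ltW h0) /= {1}/h ler_pdivrMr// mul1r (ltW Nw) => /(_ isT).
have -> : h ^+ 2 * N = h * - ip w d by rewrite expr2 -mulrA hN.
by nra.
Qed.

End ConvexGradient.

(** These three rules are stated for explicit [fun s => ...], so that the derivatives of the
    energies are built by successive [apply]. *)
Lemma is_derive_mulf {R : realType} (u w : R -> R) (t du dw : R) :
  is_derive t 1 u du -> is_derive t 1 w dw ->
  is_derive t 1 (fun s => u s * w s) (u t * dw + w t * du).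
Proof. exact: is_deriveM. Qed.

Lemma is_derive_addf {R : realType} (u w : R -> R) (t du dw : R) :
  is_derive t 1 u du -> is_derive t 1 w dw ->
  is_derive t 1 (fun s => u s + w s) (du + dw).
Proof. exact: is_deriveD. Qed.

Lemma is_derive_mulc {R : realType} (c : R) (u : R -> R) (t du : R) :
  is_derive t 1 u du -> is_derive t 1 (fun s => c * u s) (c * du).
Proof. exact: is_deriveZ. Qed.

(** * The trajectory and its regularity on compact intervals beyond [t0] *)

Section Trajectory.
Context {R : realType} {V : completeNormedModType R} {ip : V -> V -> R}.
Hypothesis Hip : hilbert_ip ip.
Context {m : nat} {f : 'I_m -> V -> R} {g : 'I_m -> V -> V}.
Context {alpha t0 : R} {x xd xdd : R -> V}.
Hypothesis f_convex : forall i, convex_fun (f i).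
Hypothesis f_grad : forall i, is_gradient ip (f i) (g i).
Hypothesis g_cont : forall i, continuous (g i).
Hypothesis alpha_gt3 : 3 < alpha.
Hypothesis t0_gt0 : 0 < t0.
Hypothesis x_derive : forall t, t0 < t -> is_derive t 1 x (xd t).
Hypothesis xd_within : {within `[t0, +oo[, continuous xd}.
Hypothesis xd_ac : forall T, t0 <= T -> abs_cont_on xd t0 T.
Hypothesis xd_derive :
  {ae @lebesgue_measure R, forall t, t0 < t -> is_derive t 1 xd (xdd t)}.
Hypothesis x_ode : {ae @lebesgue_measure R, forall t, t0 < t ->
  is_proj [set c + xdd t | c in Cset g (x t)] 0 (- (alpha / t) *: xd t)}.
Implicit Types (i j : 'I_m) (s t a b : R) (z : V).

Lemma xd_continuous t : t0 < t -> {for t, continuous xd}.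
Proof.
move=> t0t.
have : {within `]t0, +oo[, continuous xd}.
  apply: continuous_subspaceW xd_within => s /=.
  by rewrite !in_itv /= !andbT => /ltW.
rewrite continuous_open_subspace; last exact: interval_open.
by apply; rewrite inE /= in_itv /= t0t.
Qed.

Lemma x_continuous t : t0 < t -> {for t, continuous x}.
Proof.
move=> /x_derive[dx _].
by apply: differentiable_continuous; apply/derivable1_diffP.
Qed.

Lemma bounded_on_itv (u : R -> R) a b : t0 < a -> a <= b ->
  (forall t, t0 < t -> {for t, continuous u}) ->
  exists M : R, forall t, a <= t <= b -> u t <= M.
Proof.
move=> t0a ab uc; have [|c _ cP] := @EVT_max R u a b ab.
  apply: continuous_in_subspaceT => t; rewrite inE /= in_itv /= => /andP[at_ _].
  by apply: uc; exact: lt_le_trans at_.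
by exists (u c) => t tab; apply: cP; rewrite in_itv.
Qed.

Lemma xd_bounded a b : t0 < a -> a <= b ->
  exists M : R, forall t, a <= t <= b -> `|xd t| <= M.
Proof.
move=> t0a ab; apply: bounded_on_itv => // t t0t.
by apply: (@cvg_norm); exact: xd_continuous.
Qed.

Lemma C1_lipschitz (u du : R -> R) a b (K : R) : t0 < a ->
  (forall t, t0 < t -> is_derive t 1 u (du t)) ->
  (forall t, a <= t <= b -> `|du t| <= K) ->
  forall s t, a <= s <= b -> a <= t <= b -> `|u s - u t| <= K * `|s - t|.
Proof.
move=> t0a ud duK s t; wlog st : s t / t <= s.
  move=> H sab tab; have [/H|/ltW/H] := leP t s; first exact.
  by rewrite distrC (distrC s); exact.
move=> /andP[as_ sb] /andP[at_ tb].
have [||c] := @MVT_segment R u du t s st.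
- move=> c; rewrite in_itv /= => /andP[tc _]; apply: ud.
  by apply: lt_trans tc; exact: lt_le_trans at_.
- apply: continuous_in_subspaceT => c; rewrite inE /= in_itv /= => /andP[tc _].
  apply: differentiable_continuous; apply/derivable1_diffP.
  by have [] := ud c (lt_le_trans (lt_le_trans t0a at_) tc).
rewrite in_itv /= => /andP[tc cs] ->.
by rewrite normrM ler_wpM2r// duK// (le_trans at_ tc) (le_trans cs sb).
Qed.

Lemma abs_cont_sub a b : t0 < a -> a <= b -> abs_cont_on xd a b.
Proof.
move=> t0a ab e e0.
have [d d0 dP] := xd_ac b (ltW (lt_le_trans t0a ab)) e e0.
exists d => // n p pab; apply: dP => k; have [/andP[ap pp] pb] := pab k.
by rewrite pp (le_trans (ltW t0a) ap).
Qed.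

Section LipDom.
Variables (a b : R).
Hypotheses (t0a : t0 < a) (ab : a <= b).

Lemma lip_dom_x z : lip_dom xd a b (fun t => x t - z).
Proof.
have [M MP] := xd_bounded a b t0a ab.
apply: lip_domD; last exact: lip_dom_cst.
have M0 : 0 <= M by apply: le_trans (MP a _); rewrite ?lexx.
apply: (lip_dom_lipschitz _ _ _ _ _ M) => // s t sab tab.
(* The mean value theorem is applied to the real function r -> <x(r), v>; a factor |v| then
   cancels. *)
pose v := x s - x t.
have [v0|v0] := eqVneq `|v| 0; first by rewrite -/v v0 mulr_ge0.
have vp : 0 < `|v| by rewrite lt_neqAle eq_sym v0 normr_ge0.
rewrite -(ler_pM2r vp) -expr2 -/v -(ipxx Hip) {1}/v (ipBl Hip).
apply: (le_trans (ler_norm _)).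
rewrite mulrAC.
apply: (C1_lipschitz (fun t => ip (x t) v) (fun t => ip (xd t) v) a b) => //.
  move=> r t0r; apply: is_derive_eq.
    by apply: (is_derive_ip Hip); exact: x_derive.
  by rewrite (ipC Hip (x r)) (ip0l Hip) addr0.
move=> r rab; apply: (le_trans (ip_le_norm Hip _ _)).
by rewrite ler_wpM2r// MP.
Qed.

Lemma lip_dom_fx i : lip_dom xd a b (fun t => f i (x t)).
Proof.
have [K KP] : exists K : R, forall t, a <= t <= b -> `|ip (g i (x t)) (xd t)| <= K.
  apply: bounded_on_itv => // t t0t; apply: (@cvg_norm).
  apply: (cvg_ip Hip); last exact: xd_continuous.
  by apply: (cvg_comp x (g i)); [exact: x_continuous|exact: g_cont].
have K0 : 0 <= K by apply: le_trans (KP a _); rewrite ?lexx.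
apply: (lip_dom_lipschitz _ _ _ _ _ K) => //.
apply: (C1_lipschitz _ (fun t => ip (g i (x t)) (xd t))) => // t t0t.
exact: (is_derive_gradient_comp (f i) (g i) x t _ (f_grad i) (x_derive t t0t)).
Qed.

Lemma lip_dom_ip (u w : R -> V) : lip_dom xd a b u -> lip_dom xd a b w ->
  lip_dom xd a b (fun t => ip (u t) (w t)).
Proof.
apply: (lip_dom_bilinear _ _ _ (xd_bounded a b t0a ab)) => [p q r|p q r|p q].
- exact: ipBl.
- exact: ipBr.
- exact: ip_le_norm.
Qed.

End LipDom.

(** * Energies and their derivatives along the trajectory *)

Definition mechanical i t : R := f i (x t) + 2^-1 * ip (xd t) (xd t).

(** With h = |x - z|^2 / 2 this is t h' + (alpha - 1) h. The factor alpha - 1 produces alpha <x - z,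
    x'> in the derivative, which cancels the friction term of the equation. *)
Definition anchor z t : R :=
  t * ip (x t - z) (xd t) + (alpha - 1) * (2^-1 * ip (x t - z) (x t - z)).

(** Only the first term depends on [i], so an index minimising [energy] also minimises f_i(x) -
    f_i(z) when t > 0. *)
Definition energy (l : R) z i t : R :=
  t * t * (mechanical i t - f i z) + l * anchor z t.

Lemma lip_dom_mechanical a b i : t0 < a -> a <= b -> lip_dom xd a b (mechanical i).
Proof.
move=> t0a ab; have bd := xd_bounded a b t0a ab.
apply: lip_domD; first exact: lip_dom_fx.
apply: lip_domM => //; first exact: lip_dom_cst.
by apply: lip_dom_ip => //; exact: lip_dom_base.
Qed.

Lemma lip_dom_energy l z a b i : t0 < a -> a <= b -> lip_dom xd a b (energy l z i).
Proof.
move=> t0a ab; have bd := xd_bounded a b t0a ab.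
have hx := lip_dom_x a b t0a ab z.
have hv := lip_dom_base xd a b.
have hc := lip_dom_cst xd a b.
have hi := lip_dom_id xd a b.
apply: lip_domD; apply: lip_domM => //.
- exact: lip_domM.
- by apply: lip_domD => //; exact: lip_dom_mechanical.
- by apply: lip_domD; apply: lip_domM => //; [|apply: lip_domM => //]; apply: lip_dom_ip.
Qed.

Lemma is_derive_sqdist z t : t0 < t ->
  is_derive t 1 (fun s => 2^-1 * ip (x s - z) (x s - z)) (ip (x t - z) (xd t)).
Proof.
move=> t0t.
have dx : is_derive t 1 (fun s => x s - z) (xd t).
  rewrite -[xd t]subr0; apply: is_deriveB; exact: x_derive.
apply: is_derive_eq.
  apply: is_derive_mulc; exact: (is_derive_ip Hip _ _ _ _ _ dx dx).
by rewrite (ipC Hip (xd t)); field.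
Qed.

Section AtGoodTime.
Variable t : R.
Hypotheses (t0t : t0 < t) (xdt : is_derive t 1 xd (xdd t)).

Lemma is_derive_mechanical i :
  is_derive t 1 (mechanical i) (ip (xd t) (g i (x t) + xdd t)).
Proof.
apply: is_derive_eq.
  apply: is_derive_addf.
    exact: (is_derive_gradient_comp (f i) (g i) x t _ (f_grad i) (x_derive t t0t)).
  apply: is_derive_mulc; exact: (is_derive_ip Hip _ _ _ _ _ xdt xdt).
rewrite (ipDr Hip) (ipC Hip (xdd t)) (ipC Hip (g i _)).
by field.
Qed.

Lemma is_derive_energy l z i : is_derive t 1 (energy l z i)
  (2 * t * (mechanical i t - f i z) + t * t * ip (xd t) (g i (x t) + xdd t) +
   l * (alpha * ip (x t - z) (xd t) +
        t * (ip (xd t) (xd t) + ip (x t - z) (xdd t)))).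
Proof.
have dx : is_derive t 1 (fun s => x s - z) (xd t).
  rewrite -[xd t]subr0; apply: is_deriveB; exact: x_derive.
have dk : is_derive t 1 (fun s => mechanical i s - f i z) (ip (xd t) (g i (x t) + xdd t)).
  rewrite -[ip _ _]subr0; apply: is_deriveB; exact: is_derive_mechanical.
apply: is_derive_eq.
  apply: is_derive_addf; apply: is_derive_mulc; apply: is_derive_addf.
    apply: is_derive_mulf; exact: (is_derive_ip Hip _ _ _ _ _ dx xdt).
  by apply: is_derive_mulc; exact: is_derive_sqdist.
by rewrite /GRing.scale/=; ring.
Qed.

Hypothesis ode : is_proj [set c + xdd t | c in Cset g (x t)] 0 (- (alpha / t) *: xd t).

(** This is the variational inequality for the projection -(alpha / t) x' at the vertex g_i(x) +
    x'', divided by alpha / t. *)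
Lemma dissipation i :
  t * ip (xd t) (g i (x t) + xdd t) <= - alpha * ip (xd t) (xd t).
Proof.
have [_ /(_ i)] := is_proj_co Hip _ _ _ _ ode.
have t1 : 0 < t by exact: lt_trans t0t.
have a0 : 0 < alpha by exact: lt_trans alpha_gt3.
have k0 : 0 < alpha / t by exact: divr_gt0.
rewrite -(ipxx Hip) !(ipZl Hip) (ipZr Hip).
set N := ip (xd t) (xd t); set D := ip (xd t) (_ + _) => H.
have : (alpha / t) * (alpha / t * N + D) <= 0 by lra.
rewrite pmulr_rle0// => {}H.
have aE : alpha = t * (alpha / t) by rewrite mulrCA divff ?mulr1 ?gt_eqF.
by rewrite [X in - X]aE -subr_ge0; nra.
Qed.

(** The equation reads x'' = -(alpha / t) x' - sum_i lam_i g_i(x). The gradient inequality bounds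
    each <g_i(x), x - z> below by [r], and the weights sum to 1. *)
Lemma acceleration_bound z (r : R) : (forall j, r <= f j (x t) - f j z) ->
  t * ip (x t - z) (xdd t) <= - alpha * ip (x t - z) (xd t) - t * r.
Proof.
move=> rP.
have t1 : 0 < t by exact: lt_trans t0t.
have [[lam [lam0 lam1 E]] _] := is_proj_co Hip _ _ _ _ ode.
have H : r <= ip (\sum_i lam i *: g i (x t)) (x t - z).
  rewrite (ip_suml Hip) -[r]mul1r -lam1 mulr_suml; apply: ler_sum => j _.
  rewrite (ipZl Hip) ler_wpM2l// (le_trans (rP j))//.
  exact: (convex_gradient_le Hip (f j) (g j) (f_convex j) (f_grad j)).
have : ip (- (alpha / t) *: xd t) (x t - z) =
    ip (\sum_i lam i *: g i (x t)) (x t - z) + ip (xdd t) (x t - z).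
  by rewrite E (ipDl Hip).
rewrite (ipZl Hip) !(ipC Hip _ (x t - z)) => {}E.
have {}E : - alpha * ip (x t - z) (xd t) = t * (ip (x t - z)
    (\sum_i lam i *: g i (x t)) + ip (x t - z) (xdd t)).
  by rewrite -E; field; rewrite gt_eqF.
move: H; rewrite (ipC Hip) => H.
by rewrite E mulrDr; nra.
Qed.

(** Minimality of [i] allows r = f_i(x) - f_i(z) in [acceleration_bound]. With w = W_i - f_i(z), the
    derivative is then at most (2 - l) t w + (3 l / 2 - alpha) t |x'|^2; the two conditions on [l]
    are the signs of these coefficients. *)
Lemma derive_energy_le0 l z i : 2 <= l -> 3 * l <= 2 * alpha ->
  0 <= mechanical i t - f i z -> (forall j, energy l z i t <= energy l z j t) ->
  2 * t * (mechanical i t - f i z) + t * t * ip (xd t) (g i (x t) + xdd t) +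
   l * (alpha * ip (x t - z) (xd t) +
        t * (ip (xd t) (xd t) + ip (x t - z) (xdd t))) <= 0.
Proof.
move=> l2 la w0 imin.
have t1 : 0 < t by exact: lt_trans t0t.
have rP j : f i (x t) - f i z <= f j (x t) - f j z.
  have := imin j; rewrite /energy lerD2r ler_pM2l ?mulr_gt0// /mechanical; lra.
have H1 := dissipation i.
have H2 := acceleration_bound z _ rP.
have N0 : 0 <= ip (xd t) (xd t) by rewrite (ipxx Hip) exprn_ge0.
move: H1 H2 w0; rewrite /mechanical.
set N := ip (xd t) (xd t) in N0 *; set F := f i (x t); set q := ip (x t - z) (xdd t).
set S := ip (x t - z) (xd t); set D := ip (xd t) _ => H1 H2 w0.
have h1 : t * (t * D) <= t * (- alpha * N) by rewrite ler_pM2l.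
have h2 : l * (t * q) <= l * (- alpha * S - t * (F - f i z)).
  by rewrite ler_wpM2l//; lra.
set w := F + 2^-1 * N - f i z in w0 *.
have h3 : 0 <= (l - 2) * (t * w) by rewrite mulr_ge0 ?mulr_ge0 ?(ltW t1)//; lra.
have h4 : 0 <= (2 * alpha - 3 * l) * (t * N).
  by rewrite mulr_ge0 ?mulr_ge0 ?(ltW t1)//; lra.
have -> : 2 * t * w + t * t * D + l * (alpha * S + t * (N + q)) =
  2 * (t * w) + t * (t * D) + l * alpha * S + l * (t * N) + l * (t * q) by ring.
move: h2 h3; rewrite /w; lra.
Qed.

End AtGoodTime.

(** * Monotonicity of the energies *)

Lemma ae_good : {ae @lebesgue_measure R, forall t, t0 < t ->
  is_derive t 1 xd (xdd t) /\
  is_proj [set c + xdd t | c in Cset g (x t)] 0 (- (alpha / t) *: xd t)}.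
Proof.
apply: (@filterS2 _ _ (ae_filter_ringOfSetsType _) _ _ _ _ xd_derive x_ode).
by move=> t H1 H2 t0t; split; [exact: H1|exact: H2].
Qed.

Lemma is_derive_continuous (u : R -> R) (du : R) t :
  is_derive t 1 u du -> {for t, continuous u}.
Proof.
by move=> [du' _]; apply: differentiable_continuous; apply/derivable1_diffP.
Qed.

Lemma mechanical_nonincreasing i s t : t0 < s -> s <= t -> mechanical i t <= mechanical i s.
Proof.
move=> t0s st.
(* A single function is treated as a family indexed by [unit]. *)
have [|||_ //] := @min_family_nonincreasing R unit V xd (fun=> mechanical i) s t st _ _ _ tt.
- exact: abs_cont_sub.
- by move=> _; exact: lip_dom_mechanical.
apply: (@filterS _ _ (ae_filter_ringOfSetsType _) _ _ _ ae_good) => r H /andP[sr _].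
have t0r : t0 < r by exact: lt_le_trans sr.
have [H1 H2] := H t0r; have dk := is_derive_mechanical r t0r H1 i.
split=> _; first exact: is_derive_continuous dk.
move=> _; eexists; last exact: dk.
have r0 : 0 < r by exact: lt_trans t0r.
rewrite -(pmulr_rle0 _ r0) (le_trans (dissipation r t0r H2 i))//.
have a3 := alpha_gt3; rewrite mulNr oppr_le0 mulr_ge0//; first by lra.
by rewrite (ipxx Hip) exprn_ge0.
Qed.

Lemma energy_nonincreasing l z a b : 2 <= l -> 3 * l <= 2 * alpha ->
  (forall i t, t0 < t -> 0 <= mechanical i t - f i z) -> t0 < a -> a <= b ->
  forall i, exists j, energy l z j b <= energy l z i a.
Proof.
move=> l2 la w0 t0a ab.
apply: (@min_family_nonincreasing R 'I_m V xd) => //.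
- exact: abs_cont_sub.
- by move=> i; exact: lip_dom_energy.
apply: (@filterS _ _ (ae_filter_ringOfSetsType _) _ _ _ ae_good) => r H /andP[sr _].
have t0r : t0 < r by exact: lt_le_trans sr.
have [H1 H2] := H t0r; split=> i.
  exact: is_derive_continuous (is_derive_energy r t0r H1 l z i).
move=> imin; eexists; last exact: is_derive_energy.
by apply: derive_energy_le0 => //; exact: w0.
Qed.

(** * Limits of the energies and of the distance to level points *)

Hypothesis f_bounded : forall i, exists b : R, forall y, b <= f i y.
Variable i0 : 'I_m.

Lemma mechanical_cvg i : exists w : R, mechanical i t @[t --> +oo] --> w /\
  forall t, t0 < t -> w <= mechanical i t.
Proof.
have [b bP] := f_bounded i.
apply: (@nonincreasing_bounded_cvg _ _ t0 b) => [s t|t _].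
  exact: mechanical_nonincreasing.
by rewrite (le_trans (bP (x t)))// lerDl (ipxx Hip) mulr_ge0// exprn_ge0.
Qed.

(** This is the minimum over [i] of W_i - f_i(z); [i0] is the default index that the argmin
    requires. *)
Definition gap z t : R :=
  let k := [arg min_(i < i0) (mechanical i t - f i z)]%O in mechanical k t - f k z.

Lemma gap_le z t i : gap z t <= mechanical i t - f i z.
Proof. by rewrite /gap; case: arg_minP => // j _; apply. Qed.

Section Level.
Variable z : V.
Hypothesis z_level : forall i t, t0 < t -> f i z <= mechanical i t.

Lemma gap_ge0 t : t0 < t -> 0 <= gap z t.
Proof. by move=> t0t; rewrite subr_ge0 z_level. Qed.

(** The function is the minimum over [i] of [energy l z i], hence nonincreasing. Were it ever below
    -l, it would remain so, and the nonnegative gap would force t h' <= -1 for h = |x - z|^2 / 2,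
    contradicting [no_log_decay]. *)
Lemma gap_energy_cvg (l : R) : 2 <= l -> 3 * l <= 2 * alpha ->
  exists k : R, t * t * gap z t + l * anchor z t @[t --> +oo] --> k.
Proof.
move=> l2 la.
pose u t := t * t * gap z t + l * anchor z t.
have u_mono s t : t0 < s -> s <= t -> u t <= u s.
  move=> t0s st.
  pose k := [arg min_(i < i0) (mechanical i s - f i z)]%O.
  have [j jP] : exists j, energy l z j t <= energy l z k s.
    apply: energy_nonincreasing => // i r t0r.
    by rewrite subr_ge0 z_level.
  apply: le_trans jP; rewrite /u /energy lerD2r ler_wpM2l ?gap_le//.
  by rewrite -expr2 exprn_even_ge0.
have u_ge t : t0 < t -> - l <= u t.
  move=> t0t; rewrite leNgt; apply/negP => ut.
  apply: (@no_log_decay _ (fun s => 2^-1 * ip (x s - z) (x s - z))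
    (fun s => ip (x s - z) (xd s)) t); first exact: lt_trans t0t.
  - by move=> s ts; apply: is_derive_sqdist; exact: lt_trans ts.
  - by move=> s _; rewrite (ipxx Hip) mulr_ge0// exprn_ge0.
  - move=> s ts.
    have t0s : t0 < s by exact: lt_trans ts.
    have us := le_lt_trans (u_mono t s t0t (ltW ts)) ut.
    have g0 : 0 <= s * s * gap z s.
      by rewrite mulr_ge0 ?gap_ge0// -expr2 exprn_even_ge0.
    have {us} : l * anchor z s <= l * - 1 by move: us; rewrite /u; lra.
    rewrite ler_pM2l; last by lra.
    rewrite /anchor => H.
    have n0 : 0 <= ip (x s - z) (x s - z) by rewrite (ipxx Hip) exprn_ge0.
    have a3 := alpha_gt3.
    have : 0 <= (alpha - 1) * (2^-1 * ip (x s - z) (x s - z)).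
      by rewrite mulr_ge0 ?mulr_ge0//; lra.
    lra.
by have [k []] := @nonincreasing_bounded_cvg _ u t0 (- l) u_mono u_ge; exists k.
Qed.

Lemma anchor_gap_cvg : (exists k : R, anchor z t @[t --> +oo] --> k) /\
  exists k : R, t * t * gap z t @[t --> +oo] --> k.
Proof.
have a3 := alpha_gt3.
(* The two extreme admissible weights give a linear system that can be solved for the two terms. *)
have [|k1 k1P] := gap_energy_cvg 2 (lexx _); first by lra.
have [||k2 k2P] := gap_energy_cvg (2 * alpha / 3); [lra|lra|].
have d0 : 2 * alpha / 3 - 2 != 0 by rewrite gt_eqF//; lra.
have aP : anchor z t @[t --> +oo] --> (2 * alpha / 3 - 2)^-1 * (k2 - k1).
  rewrite (_ : anchor z = fun t => (2 * alpha / 3 - 2)^-1 *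
    ((t * t * gap z t + 2 * alpha / 3 * anchor z t) -
     (t * t * gap z t + 2 * anchor z t))).
    by apply: cvgM; [exact: cvg_cst|exact: cvgB].
  apply/funext => t; rewrite [X in _ = _ * X](_ : _ =
    (2 * alpha / 3 - 2) * anchor z t); first by rewrite mulKf.
  by ring.
split; first by eexists; exact: aP.
exists (k1 - 2 * ((2 * alpha / 3 - 2)^-1 * (k2 - k1))).
rewrite (_ : (fun t => _) = fun t => (t * t * gap z t + 2 * anchor z t) -
  2 * anchor z t); last by apply/funext => t; rewrite addrK.
by apply: cvgB => //; apply: cvgM => //; exact: cvg_cst.
Qed.

(** [anchor] has the form t h' + (alpha - 1) h required by [cvg_first_order]. *)
Lemma sqdist_cvg :
  exists k : R, 2^-1 * ip (x t - z) (x t - z) @[t --> +oo] --> k.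
Proof.
have [[k kP] _] := anchor_gap_cvg.
exists (k / (alpha - 1)).
apply: (@cvg_first_order _ _ (fun s => ip (x s - z) (xd s)) t0) => //.
  by have a3 := alpha_gt3; lra.
by move=> t; exact: is_derive_sqdist.
Qed.

(** Strict domination would keep the gap of [z] above some d > 0, so t^2 times the gap would be
    unbounded instead of convergent. *)
Lemma level_not_dominated (y : V) :
  (forall i t, t0 < t -> f i y <= mechanical i t) -> ~ (forall i, f i z < f i y).
Proof.
move=> y_level zy.
have [_ [k kP]] := anchor_gap_cvg.
pose d := f [arg min_(i < i0) (f i y - f i z)]%O y -
          f [arg min_(i < i0) (f i y - f i z)]%O z.
have d0 : 0 < d by rewrite subr_gt0.
have dle i : d <= f i y - f i z by rewrite /d; case: arg_minP => // j _; apply.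
have dgap t : t0 < t -> d <= gap z t.
  move=> t0t; apply: (le_trans (dle [arg min_(i < i0) (mechanical i t - f i z)]%O)).
  by rewrite lerD2r y_level.
move/cvgrPdist_le/(_ _ ltr01) : kP => [T [_ TP]].
(* At this time t^2 gap >= t d >= |k| + 2, which exceeds the bound k + 1 valid beyond [T]. *)
pose t := Num.max (Num.max (T + 1) (t0 + 1)) (Num.max 1 ((`|k| + 2) / d)).
have : [/\ T + 1 <= t, t0 + 1 <= t, 1 <= t & (`|k| + 2) / d <= t].
  by split; rewrite /t !le_max lexx ?orbT.
move=> [Tt t0t t1]; rewrite ler_pdivrMr// => kt.
have := TP t; rewrite ler_distlC => /(_ _)/andP[|_ H]; first by lra.
have gd : d <= gap z t by apply: dgap; lra.
have : t * d <= t * t * gap z t.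
  by rewrite -mulrA ler_wpM2l//; [lra|nra].
have := ler_norm k; lra.
Qed.

End Level.

(** * Weak convergence to a weakly Pareto optimal point *)

Lemma trajectory_weak_cvg (M : R) : (forall t, t0 <= t -> `|x t| <= M) ->
  exists xs, weak_pareto f xs /\
    forall v, ip (x t) v @[t --> +oo] --> ip xs v.
Proof.
move=> bd.
have /choice[w wP] := mechanical_cvg.
(* Hull points lie in [S]: each f_i is a convex continuous test function, and f_i(x) <= W_i, which
   tends to [w i]. *)
pose S : set V := [set z | forall i, f i z <= w i].
have S_level z : S z -> forall i t, t0 < t -> f i z <= mechanical i t.
  by move=> Sz i t t0t; rewrite (le_trans (Sz i))// (wP i).2.
have [||z Sz zlim] := @opial R V ip Hip x S t0 M bd.
- move=> z hz i; apply/ler_addgt0Pr => e e0.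
  have [/cvgrPdist_le/(_ _ e0)[T [_ TP]] _] := wP i.
  apply: (hz (f i) (f_convex i) _ _ (T + 1)) => [y|t Tt _].
    by apply: differentiable_continuous; have [] := f_grad i y.
  have := TP t; rewrite ler_distlC => /(_ _)/andP[|_]; first by lra.
  apply: le_trans; rewrite lerDl (ipxx Hip) mulr_ge0// exprn_ge0//.
- move=> y z Sy Sz.
  have [k kP] := sqdist_cvg y (S_level y Sy).
  have [l lP] := sqdist_cvg z (S_level z Sz).
  (* Polarisation: <x, y - z> = (|x - z|^2 - |x - y|^2) / 2 + (|y|^2 - |z|^2) / 2. *)
  exists (l - k + 2^-1 * (ip y y - ip z z)).
  rewrite (_ : (fun t => _) = fun t => (2^-1 * ip (x t - z) (x t - z) -
    2^-1 * ip (x t - y) (x t - y)) + 2^-1 * (ip y y - ip z z)).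
    by apply: cvgD; [exact: cvgB|exact: cvg_cst].
  apply/funext => t; rewrite !(ipBl Hip, ipBr Hip) (ipC Hip y) (ipC Hip z).
  by field.
exists z; split => // -[y yz].
(* A point dominating [z] lies in [S] as well, so the roles are exchanged: its own gap leads to the
   contradiction. *)
apply: (level_not_dominated y _ z (S_level z Sz) yz).
by apply: S_level => i; rewrite (le_trans (ltW (yz i))).
Qed.

End Trajectory.

Theorem theorem4p18 (R : realType) (V : completeNormedModType R)
    (ip : V -> V -> R) (m : nat) (f : 'I_m -> V -> R) (g : 'I_m -> V -> V)
    (alpha t0 : R) (x0 : V) (x xd xdd : R -> V) :
  hilbert_ip ip ->
  (forall i, convex_fun (f i)) ->
  (forall i, is_gradient ip (f i) (g i)) ->
  (forall i, continuous (g i)) ->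
  3 < alpha -> 0 < t0 ->
  is_solution ip g alpha t0 x0 x xd xdd ->
  (exists M : R, forall t, t0 <= t -> `|x t| <= M) ->
  (forall i, exists b : R, forall y, b <= f i y) ->
  pareto_assumption f ->
  exists xs : V, weak_pareto f xs /\
    forall v : V, ip (x t) v @[t --> +oo] --> ip xs v.
Proof.
move=> Hip cf gf gc a3 t00 [[xD _ xdC] xac _ xdD [ode _ _]] [M bd] fb pareto.
have [xs [xsP _]] : exists xs, Pw_level f (Fv f x0) xs.
  by have [+ _] := pareto x0; apply.
(* With no objective every point is vacuously dominated, which the weakly Pareto point [xs]
   excludes; otherwise [ord0] is the default index. *)
case: m => [|n] in f g cf gf gc ode fb pareto xsP *.
  by case: xsP; exists xs => -[].
exact: (trajectory_weak_cvg Hip cf gf gc a3 t00 xD xdC xac xdD ode fb ord0 M bd).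
Qed.
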